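(* Suppose that the standing assumptions (i)–(iii) of the context hold and that $\theta>\theta_{\min}$. Then for every fixed $z\in\mathcal Z$, $$\sup_{\mathbb P\in\mathcal P_{\theta,\varepsilon}(\mathcal N)}\Big\{\mathbb P\big((X,Y)\in\mathcal N\times\mathcal S^c(z)\big)-\epsilon\,\mathbb P_X(\mathcal N)\Big\}$$ equals the optimal value (which is attained) of the linear program $$\begin{aligned}\max_{w,r\in\mathbb R^N}\quad&\sum_{i\in[N]}r_i-\epsilon\sum_{i\in[N]}w_i\\ \text{s.t.}\quad&K_0+\sum_{i\in[N]}\bar\kappa_iw_i+\sum_{i\in[N]}\Delta_i(z)r_i\le\theta,\\&\sum_{i\in[N]}w_i\ge\varepsilon,\\&0\le r_i\le w_i\le\tfrac1N\quad\forall i\in[N].\end{aligned}$$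
   Context: $[N]=\{1,\dots,N\}$. Two distinct symbols are used: $\varepsilon\in(0,1]$ is a lower bound on the probability of the conditioning event, and $\epsilon\in(0,1)$ is the risk limit. $\mathcal X$ is the context space and $\mathcal Y$ the outcome space, with metrics $d_{\mathcal X},d_{\mathcal Y}$; $X,Y$ denote the two coordinates. $\mathcal Z\subseteq\mathbb R^{\dim(z)}$ is the decision set; for each $z\in\mathcal Z$, $\mathcal S(z)\subseteq\mathcal Y$ is the safety set and $\mathcal S^c(z)=\mathcal Y\setminus\mathcal S(z)$ the failure set. Given samples $(\hat x_i,\hat y_i)\in\mathcal X\times\mathcal Y$, $i\in[N]$, let $\widehat{\mathbb P}_N=\frac1N\sum_{i}\delta_{(\hat x_i,\hat y_i)}$. $W$ is the type-1 Wasserstein distance on probability distributions on $\mathcal X\times\mathcal Y$ with ground metric $d_{\mathcal X}(x,x')+d_{\mathcal Y}(y,y')$ (infimum over couplings of the expected ground metric). $x_0\in\mathcal X$ is a target context, $\gamma\ge0$, and $\mathcal N=\mathcal N_\gamma(x_0)\subseteq\mathcal X$ is a neighborhood with $x_0\in\mathcal N$, $\sup_{x\in\mathcal N}d_{\mathcal X}(x,x_0)\le\gamma$, and $\mathcal N_0(x_0)=\{x_0\}$. With $\theta>0$ and $\mathbb P_X$ the $\mathcal X$-marginal of $\mathbb P$, $$\mathcal P_{\theta,\varepsilon}(\mathcal N)=\{\mathbb P: W(\mathbb P,\widehat{\mathbb P}_N)\le\theta,\ \mathbb P_X(\mathcal N)\ge\varepsilon\}.$$ Standing assumptions: (i) $(\mathcal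 X,d_{\mathcal X})$, $(\mathcal Y,d_{\mathcal Y})$ are Polish metric spaces with their Borel $\sigma$-fields, and transport is allowed on all of $\mathcal X\times\mathcal Y$; (ii) $\mathcal N$ is Borel and the distances from each $\hat x_i$ to $\mathcal N$ and to $\mathcal N^c$ are finite; (iii) for every $z\in\mathcal Z$, $\mathcal S^c(z)$ is a nonempty Borel set and the distance from each $\hat y_i$ to it is finite. Define $\kappa_i^{\rm in}=\inf_{x\in\mathcal N}d_{\mathcal X}(\hat x_i,x)$, $\kappa_i^{\rm out}=\inf_{x\in\mathcal N^c}d_{\mathcal X}(\hat x_i,x)$, $\bar\kappa_i=\kappa_i^{\rm in}-\kappa_i^{\rm out}$, $K_0=\frac1N\sum_i\kappa_i^{\rm out}$, $\Delta_i(z)=\inf_{y\in\mathcal S^c(z)}d_{\mathcal Y}(\hat y_i,y)$, and $\theta_{\min}=\inf\{W(\mathbb P,\widehat{\mathbb P}_N): \mathbb P_X(\mathcal N)\ge\varepsilon\}$. *)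

(* Defs.v *)
From HB Require Import structures.
From mathcomp Require Import all_boot all_order all_algebra.
From mathcomp Require Import all_classical all_reals all_analysis.

Set Implicit Arguments.
Unset Strict Implicit.
Unset Printing Implicit Defensive.

Import Order.TTheory GRing.Theory Num.Theory.
Import numFieldNormedType.Exports.

Local Open Scope classical_set_scope.
Local Open Scope ring_scope.

(* Polish metric spaces carrying their Borel sigma-algebra. Completeness of
   the metric comes from [Complete]; both that structure and [Measurable]
   require a distinguished point, so the spaces are nonempty. For separable X
   and Y the product sigma-algebra of the library on X * Y is the Borel
   sigma-algebra of the product. *)
HB.mixin Record isBorelPolish d (R : realType) T
    & Metric R T & Complete T & Measurable d T := {
  polish_separable : exists2 D : set T, countable D & dense D;
  polish_measurableE : @measurable d T = <<s @open T >>
}.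

#[short(type="borelPolishType")]
HB.structure Definition BorelPolish d (R : realType) :=
  {T of Metric R T & Complete T & Measurable d T & isBorelPolish d R T}.

Section empirical_measure.
Context d (T : measurableType d) (R : realType) (n : nat).
Variable s : 'I_n.+1 -> T.
Local Open Scope ereal_scope.

(* The samples are indexed by 'I_n.+1, so that their number N = n.+1 is
   positive. *)
Definition empirical (A : set T) : \bar R :=
  (n.+1%:R^-1)%:E * \sum_(i < n.+1) \d_(s i) A.

Let mscale_msum : {measure set T -> \bar R} :=
  mscale (n.+1%:R^-1)%:nng%R (msum (fun k => \d_(s (inord k))) n.+1).

Let empiricalE : empirical = mscale_msum.
Proof.
apply/funext => A; rewrite /empirical /= /mscale /msum /=; congr (_ * _).
by apply: eq_bigr => i _; rewrite inord_val.
Qed.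

Let empirical0 : empirical set0 = 0.
Proof. by rewrite empiricalE measure0. Qed.

Let empirical_ge0 A : 0 <= empirical A.
Proof. by rewrite empiricalE measure_ge0. Qed.

Let empirical_sigma_additive : semi_sigma_additive empirical.
Proof. by rewrite empiricalE; exact: measure_semi_sigma_additive. Qed.

HB.instance Definition _ := isMeasure.Build _ _ _ empirical
  empirical0 empirical_ge0 empirical_sigma_additive.

Let empirical_setT : empirical setT = 1.
Proof.
rewrite /empirical; under eq_bigr do rewrite diracT.
by rewrite sumEFin -EFinM sumr_const card_ord mulVf.
Qed.

HB.instance Definition _ :=
  Measure_isProbability.Build _ _ _ empirical empirical_setT.

End empirical_measure.

Section wasserstein.
Context d (T : measurableType d) (R : realType).

Definition coupling (P Q : probability T R) : set (probability (T * T)%type R) :=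
  [set pi | forall A, measurable A ->
     pushforward pi fst A = P A /\ pushforward pi snd A = Q A].

Definition wasserstein1 (c : T -> T -> R) (P Q : probability T R) : \bar R :=
  ereal_inf [set (\int[pi]_u (c u.1 u.2)%:E)%E | pi in coupling P Q].

End wasserstein.

(* Equal to +oo when A is empty. *)
Definition setdist (R : realType) (T : metricType R) (x : T) (A : set T) :
  \bar R := ereal_inf [set (mdist x a)%:E | a in A].

(* The last clause, the convention at radius 0, follows from the others. *)
Definition is_neighborhood (R : realType) (T : metricType R)
    (gamma : R) (x0 : T) (Nb : set T) : Prop :=
  [/\ Nb x0,
      (ereal_sup [set (mdist x x0)%:E | x in Nb] <= gamma%:E)%E &
      gamma = 0 -> Nb = [set x0]].

Section conditional_ambiguity.
Context (R : realType) (dX dY : measure_display).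
Context (X : borelPolishType dX R) (Y : borelPolishType dY R).
Context (n : nat) (xh : 'I_n.+1 -> X) (yh : 'I_n.+1 -> Y).

Definition ground_metric (p q : X * Y) : R := mdist p.1 q.1 + mdist p.2 q.2.

Definition dist_empirical (P : probability (X * Y)%type R) : \bar R :=
  wasserstein1 ground_metric P (empirical R (fun i => (xh i, yh i))).

Definition marginalX (P : probability (X * Y)%type R) : set X -> \bar R :=
  pushforward P fst.

Definition theta_min (varepsilon : R) (Nb : set X) : \bar R :=
  ereal_inf [set dist_empirical P |
    P in [set P | (varepsilon%:E <= marginalX P Nb)%E]].

Definition ambiguity_set (theta varepsilon : R) (Nb : set X) :
    set (probability (X * Y)%type R) :=
  [set P | (dist_empirical P <= theta%:E)%E /\
           (varepsilon%:E <= marginalX P Nb)%E].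

Definition worst_case (theta varepsilon epsilon : R) (Nb : set X)
    (Sc : set Y) : \bar R :=
  ereal_sup [set (P (Nb `*` Sc) - epsilon%:E * marginalX P Nb)%E |
    P in ambiguity_set theta varepsilon Nb].

(* The [fine] below are meant under the assumption that the distances involved
   are finite. *)
Definition kappa_in (Nb : set X) i : R := fine (setdist (xh i) Nb).
Definition kappa_out (Nb : set X) i : R := fine (setdist (xh i) (~` Nb)).
Definition kappa_bar (Nb : set X) i : R := kappa_in Nb i - kappa_out Nb i.
Definition K0 (Nb : set X) : R := n.+1%:R^-1 * \sum_i kappa_out Nb i.
Definition Delta (Sc : set Y) i : R := fine (setdist (yh i) Sc).

Definition lp_feasible (theta varepsilon : R) (Nb : set X) (Sc : set Y)
    (w r : 'rV[R]_n.+1) : Prop :=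
  [/\ K0 Nb + \sum_i kappa_bar Nb i * w 0 i + \sum_i Delta Sc i * r 0 i
        <= theta,
      varepsilon <= \sum_i w 0 i &
      forall i, 0 <= r 0 i /\ r 0 i <= w 0 i /\ w 0 i <= n.+1%:R^-1].

Definition lp_objective (epsilon : R) (w r : 'rV[R]_n.+1) : R :=
  \sum_i r 0 i - epsilon * \sum_i w 0 i.

Definition lp_value (theta varepsilon epsilon : R) (Nb : set X)
    (Sc : set Y) : \bar R :=
  ereal_sup [set (lp_objective epsilon wr.1 wr.2)%:E |
    wr in [set wr | lp_feasible theta varepsilon Nb Sc wr.1 wr.2]].

End conditional_ambiguity.

(* Main.v *)
From HB Require Import structures.
Require Import Defs.
From mathcomp Require Import all_boot all_order all_algebra.
From mathcomp Require Import all_classical all_reals all_analysis.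
From mathcomp Require Import measurable_realfun lra ring.

Set Implicit Arguments.
Unset Strict Implicit.
Unset Printing Implicit Defensive.

Import Order.TTheory GRing.Theory Num.Theory.
Import numFieldNormedType.Exports.

Local Open Scope classical_set_scope.
Local Open Scope ring_scope.

(** Every transport plan splits along the samples, and only three facts about
    the destination of a unit of mass leaving a sample matter for the objective
    and the constraint: whether it lands outside the neighborhood, inside it
    with a safe outcome, or inside it with a failure outcome. These are the
    three cells of [cell], and reaching them from sample [i] costs at least
    [kappa_out i], [kappa_in i] and [kappa_in i + Delta i]. The bounds are
    approached, provided that mass moved into the neighborhood at a cost close
    to [kappa_in i] may keep the outcome of its sample, safe or not; a failure
    only helps the objective. Writing [w i] for the mass that sample [i] sends
    into the neighborhood and [r i] for the part of it that ends in failure,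
    the sum of these costs is the left-hand side of the budget constraint
    ([sum_cell_cost]).

    From measures to the program ([coupling_lp]): a coupling of [P] with the
    empirical measure gives [w] and [r] by restriction to the samples, and its
    cost dominates the step function equal to these bounds on the cells.
    Since samples may coincide, the mass above a point is shared equally among
    the samples located there; this keeps [w i <= 1 / N].

    From the program to measures ([plan_of_lp]): given [w] and [r], send the
    masses to points of the cells that are nearly closest. The distances need
    not be attained, hence an arbitrarily small excess [e] over the budget.

    Neither direction is exact: couplings only approach the Wasserstein
    distance, and points of the cells only approach the distances. The
    assumption [theta_min < theta] absorbs both errors. It provides, again
    by [coupling_lp], a point of the program that is strictly within budget;
    moving slightly towards it turns a solution for the budget [theta + eta]
    into one for [theta - eta] at the price of an arbitrarily small loss
    ([lp_tighten]). Attainment is compactness of the feasible set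
    ([lp_attained]).

    Both bounds on the cost of a coupling use that the integral of a
    nonnegative function is a supremum over the simple functions below it:
    directly for the lower bound by a step function ([ge0_le_integralT]), and
    by integrating these simple functions for the upper bound under a finitely
    supported measure ([finite_mixture]). *)

(** * Integrals of nonmeasurable functions *)

Section integrals.
Context d (T : measurableType d) (R : realType).
Local Open Scope ereal_scope.

(** Monotonicity without measurability: a simple function below [f] is also
    below [g]. *)
Lemma ge0_le_integralT (mu : {measure set T -> \bar R}) (f g : T -> \bar R) :
  (forall x, 0 <= f x) -> (forall x, f x <= g x) ->
  \int[mu]_x f x <= \int[mu]_x g x.
Proof.
move=> f0 fg; have g0 x : 0 <= g x by exact: le_trans (f0 x) (fg x).
rewrite !ge0_integralTE//; apply: ereal_sup_le => _ [h hf <-].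
by exists h => // x; exact: le_trans (hf x) (fg x).
Qed.

Lemma integral_sum_indic (mu : {measure set T -> \bar R}) (J : finType)
    (c : J -> R) (F : J -> set T) :
  (forall j, 0 <= c j)%R -> (forall j, measurable (F j)) ->
  \int[mu]_u (\sum_j c j * \1_(F j) u)%R%:E = \sum_j (c j)%:E * mu (F j).
Proof.
move=> c0 mF; under eq_integral => u _ do rewrite -sumEFin.
rewrite ge0_integral_sum//=.
- apply: eq_bigr => j _; under eq_integral => u _ do rewrite EFinM.
  rewrite ge0_integralZl_EFin//.
    by rewrite integral_indic// setIT.
  by apply/measurable_EFinP; exact: measurable_indic.
- move=> j; apply/measurable_EFinP/measurable_funM => //.
- by move=> j x _; rewrite lee_fin mulr_ge0.
Qed.

End integrals.

Section finite_mixture.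
Context d (T : measurableType d) (R : realType) (J : finType).
Variables (p : J -> R) (a : J -> T).
Hypotheses (p0 : forall j, 0 <= p j) (p1 : \sum_j p j = 1).
Local Open Scope ereal_scope.
Import HBNNSimple.

(* The atoms are listed in a sequence because finite sums of measures are
   indexed by natural numbers; the default [mzero] is never reached. *)
Let atom j : {measure set T -> \bar R} := mscale (NngNum (p0 j)) \d_(a j).
Let atoms (k : nat) : {measure set T -> \bar R} :=
  @nth {measure set T -> \bar R} mzero [seq atom j | j <- enum J] k.
Let mix : {measure set T -> \bar R} := msum atoms #|J|.

Let sum_atoms (f : {measure set T -> \bar R} -> \bar R) :
  \sum_(k < #|J|) f (atoms k) = \sum_j f (atom j).
Proof.
rewrite -(big_mkord xpredT (fun k => f (atoms k))).
have -> : #|J| = size [seq atom j | j <- enum J] by rewrite size_map cardE.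
rewrite -(big_nth (mzero : {measure set T -> \bar R}) xpredT f).
by rewrite big_map big_enum.
Qed.

Let mixE A : mix A = (\sum_j p j * \1_A (a j))%R%:E.
Proof.
rewrite /mix/= /msum (sum_atoms (fun m => m A)) -sumEFin.
by apply: eq_bigr => j _; rewrite /= /mscale/= diracE EFinM indicE.
Qed.

Let mixT : mix setT = 1.
Proof. by rewrite mixE; under eq_bigr do rewrite indicT mulr1; rewrite p1. Qed.

Let integral_mix_nnsfun (h : {nnsfun T >-> R}) :
  \int[mix]_x (h x)%:E = (\sum_j p j * h (a j))%R%:E.
Proof.
rewrite integral_measure_sum_nnsfun// (sum_atoms (fun m => \int[m]_x (h x)%:E)).
rewrite -sumEFin; apply: eq_bigr => j _.
have mh : measurable_fun setT (EFin \o h) by exact/measurable_EFinP.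
have h0 x : 0 <= (EFin \o h) x by rewrite lee_fin.
rewrite /atom ge0_integral_mscale//=; last by move=> x _; exact: h0.
by rewrite integral_dirac// diracT mul1e EFinM.
Qed.

(** The integral is only bounded, since [c] is arbitrary: a simple function
    below [c] integrates to the weighted sum of its values at the atoms. *)
Lemma finite_mixture : exists P : probability T R,
  (forall A, P A = (\sum_j p j * \1_A (a j))%R%:E) /\
  (forall c : T -> R, (forall u, 0 <= c u)%R ->
     \int[P]_u (c u)%:E <= (\sum_j p j * c (a j))%R%:E).
Proof.
pose P : probability T R := HB.pack (Measure.sort mix)
  (Measure_isProbability.Build _ _ _ mix mixT).
exists P; split; first exact: mixE.
move=> c c0; rewrite ge0_integralTE; last by move=> x; rewrite lee_fin.
apply: ge_ereal_sup => _ [h /= hc <-].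
have -> : sintegral P h = \int[mix]_x (h x)%:E.
  by rewrite integral_nnsfun// patch_setT.
rewrite integral_mix_nnsfun lee_fin; apply: ler_sum => j _.
by rewrite ler_wpM2l// -lee_fin hc.
Qed.

End finite_mixture.

(** * Splitting a coupling along coinciding samples *)

Section shares.
Context (T : Type) (R : realType) (n : nat) (s : 'I_n.+1 -> T).

Definition multiplicity i : nat := #|[pred j | `[< s j = s i >]]|.

Lemma multiplicity_neq0 i : (multiplicity i)%:R != 0 :> R.
Proof.
rewrite pnatr_eq0 -lt0n; apply/card_gt0P; exists i.
by rewrite inE.
Qed.

(** The share of sample [i] in the mass coupled to the point [t]: coinciding
    samples split it equally, so that the shares add up to one. *)
Definition share i (t : T) : R := (multiplicity i)%:R^-1 * \1_[set s i] t.

Lemma share_ge0 i t : 0 <= share i t.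
Proof. by rewrite mulr_ge0. Qed.

Lemma sum_share t : \sum_i share i t = \1_(range s) t.
Proof.
rewrite [RHS]indicE; have [|nt] := pselect (range s t); last first.
  rewrite memNset// big1// => i _.
  by rewrite /share indicE memNset ?mulr0//= => ti; apply: nt; exists i.
move=> [k _ skt]; rewrite mem_set; last by exists k.
transitivity (\sum_(i | `[< s i = s k >]) (multiplicity k)%:R^-1 : R).
  rewrite [RHS]big_mkcond; apply: eq_bigr => i _; rewrite /share indicE -skt.
  case: asboolP => sik; last by rewrite memNset ?mulr0//= => /esym.
  by rewrite sik mem_set// mulr1; congr (_%:R^-1); rewrite /multiplicity sik.
by rewrite sumr_const -[X in X *+ _]mulr1 -mulrnAr mulVf// multiplicity_neq0.
Qed.

End shares.

Section coupled_mass.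
Context d d' (U : measurableType d) (T : measurableType d') (R : realType).
Context (n : nat) (s : 'I_n.+1 -> T) (g : U -> T) (pi : probability U R).
Hypotheses (mg : measurable_fun setT g) (ms : forall i, measurable [set s i]).
Hypothesis pig : forall A, measurable A -> pi (g @^-1` A) = empirical R s A.

(** The mass of [F] attributed to sample [i] by the shares above, where [g]
    reads off the sample side of the coupling [pi]. *)
Definition coupled_mass i (F : set U) : R :=
  fine (pi (F `&` g @^-1` [set s i])) / (multiplicity s i)%:R.

Let mpre A : measurable A -> measurable (g @^-1` A).
Proof. by move=> mA; rewrite -[X in measurable X]setTI; exact: mg. Qed.

Let mFs F i : measurable F -> measurable (F `&` g @^-1` [set s i]).
Proof. by move=> mF; apply: measurableI => //; exact: mpre. Qed.

Lemma coupled_mass_ge0 i F : 0 <= coupled_mass i F.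
Proof. by rewrite divr_ge0// fine_ge0. Qed.

Lemma coupled_mass_mono i F G : measurable F -> measurable G -> F `<=` G ->
  coupled_mass i F <= coupled_mass i G.
Proof.
move=> mF mG FG; rewrite ler_wpM2r ?invr_ge0//.
rewrite fine_le ?fin_num_measure//; try exact: mFs.
by apply: le_measure; rewrite ?inE; [exact: mFs|exact: mFs|exact: setSI].
Qed.

Lemma coupled_massD i F G : measurable F -> measurable G -> G `<=` F ->
  coupled_mass i (F `\` G) = coupled_mass i F - coupled_mass i G.
Proof.
move=> mF mG GF; rewrite /coupled_mass -mulrBl; congr (_ / _); apply/eqP.
rewrite eq_sym subr_eq; apply/eqP.
rewrite -fineD ?fin_num_measure//; try exact: mFs.
  rewrite (measureDI _ (mFs i mF) mG); congr (fine (pi _ + pi _)).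
    by rewrite !setDE setIAC.
  by rewrite setIAC; congr (_ `&` _); exact/setIidr.
by apply: mFs; exact: measurableD.
Qed.

(** A point of multiplicity [m] has empirical mass [m / N]. *)
Lemma coupled_massT i : coupled_mass i setT = n.+1%:R^-1.
Proof.
rewrite /coupled_mass setTI pig// /empirical.
have -> : (\sum_(j < n.+1) \d_(s j) [set s i] =
           (multiplicity s i)%:R%:E :> \bar R)%E.
  rewrite /multiplicity -sum1_card natr_sum -sumEFin [RHS]big_mkcond.
  apply: eq_bigr => j _; rewrite diracE unfold_in /=; case: asboolP => sij.
    by rewrite mem_set.
  by rewrite memNset.
by rewrite -EFinM/= mulfK// multiplicity_neq0.
Qed.

Let mrange : measurable (range s).
Proof.
rewrite -bigcup_imset1; apply: fin_bigcup_measurable => // i _; exact: ms.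
Qed.

Let coupled_mass_indic i F u :
  (multiplicity s i)%:R^-1 * \1_(F `&` g @^-1` [set s i]) u =
  share R s i (g u) * \1_F u.
Proof. by rewrite indicI -mulrA; congr (_ * _); rewrite [LHS]mulrC. Qed.

Let integral_coupled_mass (K : finType) (C : 'I_n.+1 * K -> R)
    (F : K -> set U) :
  (forall j, 0 <= C j) -> (forall k, measurable (F k)) ->
  (\int[pi]_u (\sum_j C j * (share R s j.1 (g u) * \1_(F j.2) u))%:E =
   (\sum_j C j * coupled_mass j.1 (F j.2))%:E)%E.
Proof.
move=> C0 mF.
under eq_integral => u _ do
  (under eq_bigr => j _ do rewrite -coupled_mass_indic mulrA).
rewrite integral_sum_indic; last 2 first.
- by move=> j; rewrite mulr_ge0.
- by move=> j; exact: mFs.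
rewrite -sumEFin; apply: eq_bigr => j _.
rewrite /coupled_mass mulrA mulrAC [RHS]EFinM fineK// fin_num_measure//.
exact: mFs.
Qed.

(** Almost surely the sample side lies in the support of the empirical measure,
    where the shares add up to one. *)
Lemma coupled_mass_sum F :
  measurable F -> \sum_i coupled_mass i F = fine (pi F).
Proof.
move=> mF; have mG := mpre mrange.
have -> : pi F = pi (F `&` g @^-1` range s).
  rewrite (measureDI _ mF mG) [X in (X + _)%E](_ : _ = 0%E) ?add0e//.
  apply/eqP; rewrite eq_le measure_ge0 andbT.
  apply: (@le_trans _ _ (pi (g @^-1` (~` range s)))).
    apply: le_measure; rewrite ?inE; first exact: measurableD.
      by apply: mpre; exact: measurableC.
    by move=> u [].
  rewrite pig; last exact: measurableC.
  rewrite /empirical big1 ?mule0// => i _; rewrite diracE memNset//.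
  by move=> /(_ _); apply; exists i.
apply: EFin_inj; rewrite fineK; last first.
  by rewrite fin_num_measure//; exact: measurableI.
have := @integral_coupled_mass unit (cst 1) (cst F) (fun=> ler01) (fun=> mF).
rewrite -(pair_bigA _ (fun i _ => 1 * coupled_mass i F))/=.
under eq_bigr => i _ do rewrite big_const card_unit/= addr0 mul1r.
move=> <-.
rewrite -(setIT (F `&` _)) -integral_indic//; last exact: measurableI.
apply: eq_integral => u _; congr EFin.
rewrite -(pair_bigA _ (fun i _ => 1 * (share R s i (g u) * \1_F u)))/=.
under eq_bigr => i _ do rewrite big_const card_unit/= addr0 mul1r.
by rewrite -mulr_suml sum_share indicI [LHS]mulrC.
Qed.

(** The transport cost is bounded below by a step function: given the sample
    [i] and the cell [k] in which the mass is found, the cost is at least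
    [C i k], and the cells are disjoint by the bound on the indicators. *)
Lemma coupled_mass_cost (K : finType) (C : 'I_n.+1 -> K -> R) (F : K -> set U)
    (c : U -> R) :
  (forall i k, 0 <= C i k) -> (forall k, measurable (F k)) ->
  (forall u, 0 <= c u) -> (forall u, \sum_k \1_(F k) u <= 1 :> R) ->
  (forall i k u, g u = s i -> F k u -> C i k <= c u) ->
  ((\sum_i \sum_k C i k * coupled_mass i (F k))%:E <= \int[pi]_u (c u)%:E)%E.
Proof.
move=> C0 mF c0 F1 Cc; rewrite pair_bigA.
rewrite -(@integral_coupled_mass _ (fun j => C j.1 j.2))//.
apply: ge0_le_integralT => u; rewrite lee_fin.
  by apply: sumr_ge0 => j _; rewrite !mulr_ge0 ?share_ge0.
rewrite -(pair_bigA _ (fun i k => C i k * (share R s i (g u) * \1_(F k) u)))/=.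
apply: (@le_trans _ _ (\sum_i \sum_k c u * (share R s i (g u) * \1_(F k) u))).
  apply: ler_sum => i _; apply: ler_sum => k _.
  rewrite /share indicE; have [/set_mem gsi|] := boolP (g u \in _); last first.
    by rewrite mulr0 !mul0r !mulr0.
  rewrite indicE; have [/set_mem Fku|] := boolP (u \in _); last first.
    by rewrite !mulr0.
  by rewrite !mulr1 ler_wpM2r ?invr_ge0//; exact: Cc.
under eq_bigr => i _ do rewrite -!mulr_sumr.
rewrite -mulr_sumr -mulr_suml sum_share -[leRHS]mulr1 ler_wpM2l//.
by rewrite mulr_ile1// ?sumr_ge0// indicE; case: (_ \in _).
Qed.

End coupled_mass.

(** * Distances to sets and measurability of points *)

Section setdist.
Context (R : realType) (T : metricType R).
Implicit Types (x : T) (A : set T).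

Lemma fine_setdist_ge0 x A : 0 <= fine (setdist x A).
Proof.
apply: fine_ge0; apply: le_ereal_inf_tmp => _ [a _ <-].
by rewrite lee_fin mdist_ge0.
Qed.

Lemma fine_setdist_le x A a :
  setdist x A \is a fin_num -> A a -> fine (setdist x A) <= mdist x a.
Proof.
move=> xA Aa; rewrite -lee_fin fineK//.
by apply: ereal_inf_lbound; exists a.
Qed.

Lemma fine_setdist_near x A e : setdist x A \is a fin_num -> 0 < e ->
  exists2 a, A a & mdist x a <= fine (setdist x A) + e.
Proof.
move=> xA e0; have [_ [a Aa <-]] := lb_ereal_inf_adherent e0 xA.
rewrite -/(setdist x A) -[setdist x A]fineK// -EFinD lte_fin => /ltW ax.
by exists a.
Qed.

End setdist.

(** Points are closed, hence Borel, so a coupling can be restricted to the mass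
    that goes to one sample. *)
Lemma measurable_point d (R : realType) (X : borelPolishType d R) (x : X) :
  measurable [set x].
Proof.
rewrite -[[set x]]setCK; apply: measurableC.
rewrite polish_measurableE; apply: sub_sigma_algebra.
apply: closed_openC; apply: accessible_closed_set1.
exact/hausdorff_accessible/metric_hausdorff.
Qed.

(** * The linear program *)

Section linear_program.
Context (R : realType) (dX dY : measure_display).
Context (X : borelPolishType dX R) (Y : borelPolishType dY R).
Context (n : nat) (xh : 'I_n.+1 -> X) (yh : 'I_n.+1 -> Y).
Variables (varepsilon epsilon : R) (Nb : set X) (Sc : set Y).
Implicit Types w r : 'rV[R]_n.+1.

Definition lp_cost w r : R :=
  K0 xh Nb + \sum_i kappa_bar xh Nb i * w 0 i + \sum_i Delta yh Sc i * r 0 i.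

Definition lp_box w r : Prop :=
  forall i, 0 <= r 0 i /\ r 0 i <= w 0 i /\ w 0 i <= n.+1%:R^-1.

Notation feasible theta :=
  (lp_feasible xh yh theta varepsilon Nb Sc).
Notation objective := (lp_objective epsilon).

Lemma sum_invn : \sum_(i < n.+1) n.+1%:R^-1 = 1 :> R.
Proof. by rewrite sumr_const card_ord -[LHS]mulr_natl mulfV. Qed.

Lemma lp_objective_bound theta w r : 0 <= epsilon <= 1 -> feasible theta w r ->
  -1 <= objective w r <= 1.
Proof.
move=> /andP[e0 e1] [_ _ wr].
have r0 : 0 <= \sum_i r 0 i by apply: sumr_ge0 => i _; have [] := wr i.
have rw : \sum_i r 0 i <= \sum_i w 0 i.
  by apply: ler_sum => i _; have [_ []] := wr i.
have w1 : \sum_i w 0 i <= 1.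
  by rewrite -sum_invn; apply: ler_sum => i _; have [_ []] := wr i.
rewrite /lp_objective; nra.
Qed.

Definition mix_row (t : R) w w0 : 'rV[R]_n.+1 := (1 - t) *: w + t *: w0.

Lemma sum_mix (a : 'I_n.+1 -> R) t w w0 :
  \sum_i a i * mix_row t w w0 0 i =
  (1 - t) * \sum_i a i * w 0 i + t * \sum_i a i * w0 0 i.
Proof.
rewrite !mulr_sumr -big_split; apply: eq_bigr => i _ /=.
by rewrite !mxE; ring.
Qed.

Lemma sum_mix1 t w w0 : \sum_i mix_row t w w0 0 i =
  (1 - t) * \sum_i w 0 i + t * \sum_i w0 0 i.
Proof.
rewrite !mulr_sumr -big_split; apply: eq_bigr => i _ /=.
by rewrite !mxE.
Qed.

(** The constraints are linear, so a segment from any solution towards a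
    strictly feasible one gains budget linearly, while the objective, confined
    to [[-1, 1]], loses at most twice the step length. *)
Lemma lp_tighten theta0 theta w0 r0 delta :
  0 <= epsilon <= 1 -> feasible theta0 w0 r0 -> theta0 < theta -> 0 < delta ->
  exists2 eta, 0 < eta & forall w r, feasible (theta + eta) w r ->
    exists w' r', feasible (theta - eta) w' r' /\
      objective w r - delta <= objective w' r'.
Proof.
move=> e01 f0 tt d0; pose t := Num.min 1 (delta / 2).
have t0 : 0 < t by rewrite lt_min ltr01 divr_gt0.
have t1 : t <= 1 by rewrite ge_min lexx.
have td : t <= delta / 2 by rewrite ge_min lexx orbT.
(* A step [t] replaces a budget [theta + eta] by
   [(1 - t) * (theta + eta) + t * theta0], which is at most [theta - eta] as
   soon as [2 * eta <= t * (theta - theta0)]. *)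
exists (t * (theta - theta0) / 2).
  by rewrite divr_gt0// mulr_gt0// subr_gt0.
move=> w r f; exists (mix_row t w w0), (mix_row t r r0).
have /andP[lb0 ub0] := lp_objective_bound e01 f0.
have /andP[lb ub] := lp_objective_bound e01 f.
move: f f0 => [c1 s1 b1] [c2 s2 b2].
split; last first.
  have -> : objective (mix_row t w w0) (mix_row t r r0) =
      objective w r - t * (objective w r - objective w0 r0).
    by rewrite /lp_objective !sum_mix1; ring.
  rewrite lerD2l lerN2 (@le_trans _ _ (t * 2))//.
    by rewrite ler_wpM2l ?(ltW t0)//; lra.
  by move: td; lra.
split.
- move: c1 c2; rewrite !sum_mix.
  move: (\sum_i _ * w 0 i) (\sum_i _ * r 0 i) (K0 _ _).
  move: (\sum_i _ * w0 0 i) (\sum_i _ * r0 0 i) => a b c e k.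
  by nra.
- rewrite sum_mix1; move: s1 s2; move: (\sum_i w 0 i) (\sum_i w0 0 i) => a b.
  by nra.
- move=> i; have [? [? w1]] := b1 i; have [? [? w01]] := b2 i.
  have mixle (a b c e : R) : a <= c -> b <= e ->
      (1 - t) * a + t * b <= (1 - t) * c + t * e.
    by move=> ac be; rewrite lerD// ler_wpM2l// ?subr_ge0// ltW.
  rewrite !mxE; split; [|split]; last first.
  - by have := mixle _ _ _ _ w1 w01; rewrite -mulrDl subrK mul1r.
  - exact: mixle.
  - by rewrite addr_ge0// mulr_ge0// ?subr_ge0// ltW.
Qed.

(** The feasible set is a closed subset of a product of two cubes. *)
Lemma lp_attained theta : (exists w r, feasible theta w r) ->
  exists w r, feasible theta w r /\
    (objective w r)%:E = lp_value xh yh theta varepsilon epsilon Nb Sc.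
Proof.
move=> [w0 [r0 f0]].
pose rows : Type := ('rV[R]_n.+1 * 'rV[R]_n.+1)%type.
pose A : set rows := [set wr | feasible theta wr.1 wr.2].
have wcont i : continuous (fun wr : rows => wr.1 0 i).
  move=> wr.
  apply: (@continuous_comp _ _ _ fst (fun v : 'rV[R]_n.+1 => v 0 i)).
    exact: cvg_fst.
  exact: coord_continuous.
have rcont i : continuous (fun wr : rows => wr.2 0 i).
  move=> wr.
  apply: (@continuous_comp _ _ _ snd (fun v : 'rV[R]_n.+1 => v 0 i)).
    exact: cvg_snd.
  exact: coord_continuous.
have sumcont (F : 'I_n.+1 -> rows -> R) :
    (forall i, continuous (F i)) -> continuous (fun wr => \sum_i F i wr).
  by move=> cF wr; apply: cvg_big => [|i _]; [exact: add_continuous|exact: cF].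
have le_closed (f h : rows -> R) : continuous f -> continuous h ->
    closed [set wr | f wr <= h wr].
  move=> cf ch; under eq_set => wr do rewrite -subr_ge0.
  apply: (@preimage_closed _ _ (fun wr => h wr - f wr) [set x | 0 <= x]).
    by move=> wr _; apply: continuousB; [exact: ch|exact: cf].
  exact: closed_ge.
have cA : compact A.
  pose B : set 'rV[R]_n.+1 :=
    [set v : 'rV[R]_n.+1 | forall i, `[0, n.+1%:R^-1]%classic (v ord0 i)].
  have cB : compact B.
    have cB := @rV_compact R n.+1 (fun=> `[0, n.+1%:R^-1]%classic).
    exact: (cB (fun=> @segment_compact R _ _)).
  apply: (@subclosed_compact _ A (B `*` B)); first last.
  - move=> [w r] [_ _ b]; split=> i /=; rewrite in_itv/=;
      have [r0_ [rw w1]] := b i; apply/andP; split=> //.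
    + exact: le_trans rw.
    + exact: le_trans w1.
  - exact: (@compact_setX _ _ B B cB cB).
  have -> : A =
     [set wr : rows | K0 xh Nb + \sum_i kappa_bar xh Nb i * wr.1 0 i +
                      \sum_i Delta yh Sc i * wr.2 0 i <= theta] `&`
     ([set wr : rows | varepsilon <= \sum_i wr.1 0 i] `&`
      \bigcap_(i in setT) ([set wr : rows | 0 <= wr.2 0 i] `&`
       ([set wr : rows | wr.2 0 i <= wr.1 0 i] `&`
        [set wr : rows | wr.1 0 i <= n.+1%:R^-1]))).
    apply/seteqP; split => [wr [c e b]|wr [c [e b]]].
      by split=> //; split=> // i _; have [? []] := b i.
    by split=> // i; have [? []] := b i I.
  have scale (a : R) (f : rows -> R) :
      continuous f -> continuous (fun wr => a * f wr).
    by move=> cf wr; apply: continuousM; [exact: cst_continuous|exact: cf].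
  apply: closedI; [|apply: closedI; [|apply: closed_bigI => i _]].
  - apply: le_closed; last exact: cst_continuous.
    move=> wr; apply: cvgD; last by apply: sumcont => i; exact: scale.
    by apply: cvgD; [exact: cvg_cst|apply: sumcont => i; exact: scale].
  - by apply: le_closed; [exact: cst_continuous|exact: sumcont].
  - apply: closedI; [|apply: closedI]; apply: le_closed => //;
      exact: cst_continuous.
have cobj : continuous (fun wr : rows => objective wr.1 wr.2).
  move=> wr; apply: cvgB; first exact: sumcont.
  by apply: cvgM; [exact: cvg_cst|exact: sumcont].
have A0 : A !=set0 by exists (w0, r0).
have [[w r] /set_mem Awr wrmax] := compact_EVT_max A0 cA
  (continuous_subspaceT cobj).
exists w, r; split=> //; apply/eqP; rewrite eq_le; apply/andP; split.
  by apply: ereal_sup_ubound; exists (w, r).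
apply: ge_ereal_sup => _ [[w' r'] f' <-]; rewrite lee_fin.
by apply: (wrmax (w', r')); exact/mem_set.
Qed.

End linear_program.

(** * Transport plans and the linear program *)

Section transport.
Context (R : realType) (dX dY : measure_display).
Context (X : borelPolishType dX R) (Y : borelPolishType dY R).
Context (n : nat) (xh : 'I_n.+1 -> X) (yh : 'I_n.+1 -> Y).
Variables (Nb : set X) (Sc : set Y).
Hypotheses (mNb : measurable Nb) (mSc : measurable Sc).
Hypothesis Nb_fin : forall i, setdist (xh i) Nb \is a fin_num /\
                              setdist (xh i) (~` Nb) \is a fin_num.
Hypothesis Sc_fin : forall i, setdist (yh i) Sc \is a fin_num.

Let s i := (xh i, yh i).

(** [None] is the outside of the neighborhood; the boolean says whether the
    outcome inside the neighborhood is a failure. *)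
Definition cell (k : option bool) : set (X * Y) :=
  match k with
  | None => ~` Nb `*` setT
  | Some false => Nb `*` ~` Sc
  | Some true => Nb `*` Sc
  end.

Definition cell_cost i (k : option bool) : R :=
  match k with
  | None => kappa_out xh Nb i
  | Some false => kappa_in xh Nb i
  | Some true => kappa_in xh Nb i + Delta yh Sc i
  end.

(** The mass [1 / N] of sample [i] split over the cells. *)
Definition cell_mass (w r : 'rV[R]_n.+1) i (k : option bool) : R :=
  match k with
  | None => n.+1%:R^-1 - w 0 i
  | Some false => w 0 i - r 0 i
  | Some true => r 0 i
  end.

Lemma sum_cells (F : option bool -> R) :
  \sum_k F k = F None + F (Some false) + F (Some true).
Proof.
rewrite (bigD1 None)//= (bigD1 (Some false))//= (bigD1 (Some true))//=.
by rewrite big1 ?addr0 ?addrA// => -[[]|].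
Qed.

Lemma sum_cell_mass w r i : \sum_k cell_mass w r i k = n.+1%:R^-1.
Proof. by rewrite sum_cells/=; ring. Qed.

(** The budget constraint is the total cost of moving the masses to their cells:
    [K0] prices all mass as if sent outside, and [kappa_bar] corrects the price
    of the part that is kept inside. *)
Lemma sum_cell_cost w r :
  \sum_i \sum_k cell_cost i k * cell_mass w r i k = lp_cost xh yh Nb Sc w r.
Proof.
rewrite /lp_cost /K0 mulr_sumr -!big_split; apply: eq_bigr => i _ /=.
rewrite sum_cells/= /kappa_bar; ring.
Qed.

Lemma cell_cost_ge0 i k : 0 <= cell_cost i k.
Proof. by case: k => [[]|]; rewrite ?addr_ge0 ?fine_setdist_ge0. Qed.

Lemma measurable_cell k : measurable (cell k).
Proof. by case: k => [[]|]; apply: measurableX => //; exact: measurableC. Qed.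

Lemma cell_cost_le i k p : cell k p -> cell_cost i k <= ground_metric p (s i).
Proof.
have [fin fout] := Nb_fin i.
rewrite /ground_metric (metric_sym p.1) (metric_sym p.2).
case: k => [[]|] [p1 p2] /=.
- by rewrite lerD// fine_setdist_le.
- by rewrite -[leLHS]addr0 lerD ?mdist_ge0// fine_setdist_le.
- by rewrite -[leLHS]addr0 lerD ?mdist_ge0// fine_setdist_le.
Qed.

Lemma ground_metric_ge0 (p q : X * Y) : 0 <= ground_metric p q :> R.
Proof. by rewrite addr_ge0 ?mdist_ge0. Qed.

Lemma sum_cell_indic (p : X * Y) : \sum_k \1_(cell k) p = 1 :> R.
Proof.
rewrite sum_cells !indicE /cell.
rewrite !in_setX !in_setC in_setT.
by case: (p.1 \in Nb); case: (p.2 \in Sc); rewrite /= ?add0r ?addr0.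
Qed.

(** Take for [w i] and [r i] the mass coupled to sample [i] that lies over the
    neighborhood, respectively over its failure part. The masses of the three
    cells are then those of [cell_mass], and each costs at least [cell_cost]. *)
Lemma coupling_lp (P : probability (X * Y)%type R) theta
    (pi : probability ((X * Y) * (X * Y))%type R) :
  coupling P (empirical R s) pi ->
  (\int[pi]_u (ground_metric u.1 u.2)%:E <= theta%:E)%E ->
  exists w r, [/\ lp_cost xh yh Nb Sc w r <= theta, lp_box w r,
    (\sum_i w 0 i)%:E = marginalX P Nb & (\sum_i r 0 i)%:E = P (Nb `*` Sc)].
Proof.
move=> piP pile.
have ms i : measurable [set s i].
  rewrite (_ : [set s i] = [set xh i] `*` [set yh i]).
    by apply: measurableX; exact: measurable_point.
  apply/seteqP; split=> [_ ->//|[x y] [/= -> ->]//].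
have pig A : measurable A -> pi (snd @^-1` A) = empirical R s A.
  by move=> mA; have [_ <-] := piP A mA.
have mfst A : measurable A ->
    measurable (fst @^-1` A : set ((X * Y) * (X * Y))).
  by move=> mA; rewrite -[X in measurable X]setTI; exact: measurable_fst.
pose m i A := coupled_mass s snd pi i (fst @^-1` A).
have mN : measurable (Nb `*` [set: Y]) by exact: measurableX.
have mNS : measurable (Nb `*` Sc) by exact: measurableX.
pose w : 'rV[R]_n.+1 := \row_i m i (Nb `*` setT).
pose r : 'rV[R]_n.+1 := \row_i m i (Nb `*` Sc).
have mT i : m i setT = n.+1%:R^-1.
  by rewrite /m preimage_setT (coupled_massT ms pig).
have massE i k : m i (cell k) = cell_mass w r i k.
  case: k => [[]|]; rewrite /= !mxE//.
  - rewrite -coupled_massD//; try exact: mfst; last first.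
      by move=> u [].
    congr coupled_mass.
    apply/seteqP; split => [u [uN uS]|u [[uN _] uNS]]; split=> //.
    + by move=> [].
    + by move=> uS; exact: uNS.
  - rewrite -(mT i) -coupled_massD//; try exact: mfst.
    congr coupled_mass; apply/seteqP; split => [u [uN _]|u [_ uN]]; split=> //.
    + by move=> [].
    + by move=> uN'; apply: uN.
have sumE A : measurable A -> (\sum_i m i A)%:E = P A.
  move=> mA; have mA' := mfst _ mA.
  rewrite (coupled_mass_sum _ ms pig)// fineK ?fin_num_measure//.
  by have [<- _] := piP A mA.
exists w, r; split.
- rewrite -sum_cell_cost -lee_fin; apply: le_trans pile.
  under eq_bigr do under eq_bigr do rewrite -massE.
  apply: (@coupled_mass_cost _ _ _ _ _ _ s snd pi measurable_snd ms _ cell_cost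
    (fun k => fst @^-1` cell k) (fun u => ground_metric u.1 u.2)).
  + by move=> i k; exact: cell_cost_ge0.
  + by move=> k; apply: mfst; exact: measurable_cell.
  + by move=> u; exact: ground_metric_ge0.
  + by move=> u; rewrite -(sum_cell_indic u.1).
  + by move=> i k u /= -> ?; exact: cell_cost_le.
- move=> i; rewrite !mxE; split; first exact: coupled_mass_ge0.
  split; last rewrite -(mT i); apply: coupled_mass_mono => //; try exact: mfst.
  by move=> u [].
- under eq_bigr do rewrite mxE.
  by rewrite sumE// /marginalX /pushforward; congr (P _);
    apply/seteqP; split => [p []|p].
- by under eq_bigr do rewrite mxE; rewrite sumE.
Qed.

(** Failure may have larger probability than [\sum_i r 0 i]: the mass
    [w 0 i - r 0 i] keeps the outcome of the sample, which can itself be a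
    failure at no cost. *)
Lemma plan_of_lp w r e : lp_box w r -> 0 < e ->
  exists P : probability (X * Y)%type R,
  [/\ (dist_empirical xh yh P <= (lp_cost xh yh Nb Sc w r + e)%:E)%E,
      marginalX P Nb = (\sum_i w 0 i)%:E &
      ((\sum_i r 0 i)%:E <= P (Nb `*` Sc))%E].
Proof.
move=> box e0; have e20 : 0 < e / 2 by rewrite divr_gt0.
have near_in i : exists x, Nb x /\ mdist (xh i) x <= kappa_in xh Nb i + e / 2.
  by have [x ? ?] := fine_setdist_near (Nb_fin i).1 e20; exists x.
have near_out i :
    exists x, (~` Nb) x /\ mdist (xh i) x <= kappa_out xh Nb i + e / 2.
  by have [x ? ?] := fine_setdist_near (Nb_fin i).2 e20; exists x.
have near_fail i : exists y, Sc y /\ mdist (yh i) y <= Delta yh Sc i + e / 2.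
  by have [y ? ?] := fine_setdist_near (Sc_fin i) e20; exists y.
have [xin xinP] := choice near_in.
have [xout xoutP] := choice near_out.
have [yin yinP] := choice near_fail.
pose J : finType := ('I_n.+1 * option bool)%type.
pose atom (j : J) : X * Y :=
  match j.2 with
  | None => (xout j.1, yh j.1)
  | Some false => (xin j.1, yh j.1)
  | Some true => (xin j.1, yin j.1)
  end.
pose mass (j : J) := cell_mass w r j.1 j.2.
have sumJ (F : J -> R) : \sum_j F j = \sum_i \sum_k F (i, k).
  by rewrite pair_bigA; apply: eq_bigr => -[].
have mass0 j : 0 <= mass j.
  have [? [? ?]] := box j.1.
  by rewrite /mass; case: j.2 => [[]|]//=; rewrite subr_ge0.
have massi i : \sum_k mass (i, k) = n.+1%:R^-1 by exact: sum_cell_mass.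
have mass1 : \sum_j mass j = 1.
  by rewrite sumJ; under eq_bigr do rewrite massi; exact: sum_invn.
have [P [PE _]] := finite_mixture atom mass0 mass1.
have [pi [piE pi_int]] := finite_mixture (fun j => (atom j, s j.1)) mass0 mass1.
have atom_cost j : ground_metric (atom j) (s j.1) <= cell_cost j.1 j.2 + e.
  have [[_ xi] [_ xo] [_ yi]] := And3 (xinP j.1) (xoutP j.1) (yinP j.1).
  rewrite /ground_metric (metric_sym (atom j).1) (metric_sym (atom j).2).
  by rewrite /atom /cell_cost; case: j.2 => [[]|] /=; rewrite ?mdistxx; lra.
exists P; split.
- apply: (@le_trans _ _ (\int[pi]_u (ground_metric u.1 u.2)%:E)%E).
    apply: ereal_inf_lbound; exists pi => // A mA.
    split; first by rewrite PE /pushforward piE.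
    rewrite /pushforward piE /empirical.
    rewrite (_ : \sum_j _ = \sum_i \sum_k mass (i, k) * \1_A (s i)); last first.
      by rewrite sumJ.
    under eq_bigr do rewrite -mulr_suml massi.
    by rewrite -mulr_sumr EFinM -sumEFin.
  apply: le_trans (pi_int (fun u => ground_metric u.1 u.2) _) _.
    by move=> u; exact: ground_metric_ge0.
  rewrite lee_fin sumJ -sum_cell_cost -[e]mul1r -mass1 (sumJ mass).
  rewrite mulr_suml -big_split; apply: ler_sum => i _ /=.
  rewrite mulr_suml -big_split; apply: ler_sum => k _ /=.
  rewrite [_ * e]mulrC [X in X + _]mulrC [X in _ + X]mulrC -mulrDr.
  by rewrite ler_wpM2l//; exact: atom_cost (i, k).
- rewrite /marginalX /pushforward PE sumJ; congr EFin; apply: eq_bigr => i _.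
  have [[xi _] [xo _]] := conj (xinP i) (xoutP i).
  rewrite sum_cells/= !indicE /atom /mass/= memNset// !mem_set//.
  by rewrite mulr0 !mulr1 add0r subrK.
- rewrite PE lee_fin sumJ; apply: ler_sum => i _.
  have [[xi _] [yi _]] := conj (xinP i) (yinP i).
  rewrite sum_cells [X in _ + X](_ : _ = r 0 i); last first.
    by rewrite /mass/= indicE mem_set ?mulr1.
  by rewrite lerDr addr_ge0// mulr_ge0.
Qed.

End transport.

(** * The worst case *)

Section ambiguity.
Context (R : realType) (dX dY : measure_display).
Context (X : borelPolishType dX R) (Y : borelPolishType dY R).
Context (n : nat) (xh : 'I_n.+1 -> X) (yh : 'I_n.+1 -> Y).
Variables (varepsilon epsilon : R) (Nb : set X) (Sc : set Y).
Hypotheses (mNb : measurable Nb) (mSc : measurable Sc).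
Hypothesis Nb_fin : forall i, setdist (xh i) Nb \is a fin_num /\
                              setdist (xh i) (~` Nb) \is a fin_num.
Hypothesis Sc_fin : forall i, setdist (yh i) Sc \is a fin_num.
Local Open Scope ereal_scope.

(** The distance is an infimum over couplings, so one of them costs strictly
    less than [theta]; its cost is the budget [theta0]. *)
Lemma lp_of_close (P : probability (X * Y)%type R) theta :
  dist_empirical xh yh P < theta%:E -> varepsilon%:E <= marginalX P Nb ->
  exists theta0 w r, [/\ (theta0 < theta)%R,
    lp_feasible xh yh theta0 varepsilon Nb Sc w r &
    (lp_objective epsilon w r)%:E =
      P (Nb `*` Sc) - epsilon%:E * marginalX P Nb].
Proof.
move=> /ereal_inf_lt[_ [pi piP <-]] pilt eP.
have int_ge0 : 0 <= \int[pi]_u (ground_metric u.1 u.2)%:E.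
  by apply: integral_ge0 => u _; rewrite lee_fin ground_metric_ge0.
have int_fin : \int[pi]_u (ground_metric u.1 u.2)%:E \is a fin_num.
  by rewrite ge0_fin_numE// (lt_trans pilt) ?ltry.
move: pilt; rewrite -(fineK int_fin) lte_fin => theta0_lt.
have pile : \int[pi]_u (ground_metric u.1 u.2)%:E <=
    (fine (\int[pi]_u (ground_metric u.1 u.2)%:E))%:E by rewrite fineK.
have [w [r [cost box wE rE]]] := coupling_lp mNb mSc Nb_fin Sc_fin piP pile.
exists (fine (\int[pi]_u (ground_metric u.1 u.2)%:E)), w, r; split=> //.
  by split=> //; rewrite -lee_fin wE.
by rewrite /lp_objective EFinB EFinM rE wE.
Qed.

(** The slack [eta] pays for the points of the cells that are not quite
    closest. *)
Lemma close_of_lp theta eta w r : (0 < eta)%R ->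
  lp_feasible xh yh (theta - eta) varepsilon Nb Sc w r ->
  exists2 P, ambiguity_set xh yh theta varepsilon Nb P &
    (lp_objective epsilon w r)%:E <=
      P (Nb `*` Sc) - epsilon%:E * marginalX P Nb.
Proof.
move=> eta0 [cost ew box].
have [P [dP wE rP]] := plan_of_lp Nb_fin Sc_fin box eta0.
exists P; first split.
- by apply: le_trans dP _; rewrite lee_fin -lerBrDr.
- by rewrite wE lee_fin.
- by rewrite /lp_objective EFinB EFinM wE leeB.
Qed.

End ambiguity.

Theorem theorem1 (R : realType) (dX dY : measure_display)
    (X : borelPolishType dX R) (Y : borelPolishType dY R)
    (n : nat) (xh : 'I_n.+1 -> X) (yh : 'I_n.+1 -> Y)
    (m : nat) (Z : set 'rV[R]_m) (S : 'rV[R]_m -> set Y)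
    (gamma : R) (x0 : X) (Nb : set X)
    (theta varepsilon epsilon : R)
    (gamma_ge0 : 0 <= gamma)
    (Nb_x0 : is_neighborhood gamma x0 Nb)
    (theta_gt0 : 0 < theta)
    (varepsilon01 : 0 < varepsilon /\ varepsilon <= 1)
    (epsilon01 : 0 < epsilon /\ epsilon < 1)
    (Nb_borel : measurable Nb)
    (Nb_fin : forall i, setdist (xh i) Nb \is a fin_num /\
                        setdist (xh i) (~` Nb) \is a fin_num)
    (Sc_ok : forall z, Z z ->
       [/\ ~` S z !=set0, measurable (~` S z) &
           forall i, setdist (yh i) (~` S z) \is a fin_num])
    (theta_gt_min : (theta_min xh yh varepsilon Nb < theta%:E)%E)
    (z : 'rV[R]_m) (Zz : Z z) :
  worst_case xh yh theta varepsilon epsilon Nb (~` S z) =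
    lp_value xh yh theta varepsilon epsilon Nb (~` S z) /\
  exists w r : 'rV[R]_n.+1,
    lp_feasible xh yh theta varepsilon Nb (~` S z) w r /\
    (lp_objective epsilon w r)%:E =
      lp_value xh yh theta varepsilon epsilon Nb (~` S z).
Proof.
have [_ mSc Sc_fin] := Sc_ok z Zz.
have e01 : 0 <= epsilon <= 1.
  by case: epsilon01 => *; apply/andP; split; exact: ltW.
(* The strictly feasible point towards which both inequalities move. *)
have [_ [P0 eP0 <-] P0_close] := ereal_inf_lt theta_gt_min.
have [theta0 [w0 [r0 [theta0_lt feas0 _]]]] :=
  lp_of_close epsilon Nb_borel mSc Nb_fin Sc_fin P0_close eP0.
have relax theta1 theta2 w r : theta1 <= theta2 ->
    lp_feasible xh yh theta1 varepsilon Nb (~` S z) w r ->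
    lp_feasible xh yh theta2 varepsilon Nb (~` S z) w r.
  by move=> le12 [c ew box]; split=> //; exact: le_trans le12.
split; last first.
  by apply: lp_attained; exists w0, r0; apply: relax feas0; exact: ltW.
apply/eqP; rewrite eq_le; apply/andP; split.
- apply: ge_ereal_sup => _ [P [dP eP] <-]; apply/lee_addgt0Pr => delta delta0.
  have [eta eta0 tighten] := lp_tighten e01 feas0 theta0_lt delta0.
  have dP_lt : (dist_empirical xh yh P < (theta + eta)%:E)%E.
    by apply: le_lt_trans dP _; rewrite lte_fin ltrDl.
  have [theta1 [w [r [theta1_lt feas <-]]]] :=
    lp_of_close epsilon Nb_borel mSc Nb_fin Sc_fin dP_lt eP.
  have [w' [r' [feas' obj]]] :=
    tighten w r (relax _ _ _ _ (ltW theta1_lt) feas).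
  apply: (@le_trans _ _ (lp_objective epsilon w' r' + delta)%:E).
    by rewrite lee_fin -lerBlDr.
  rewrite EFinD leeD2r//; apply: ereal_sup_ubound; exists (w', r') => //=.
  by apply: relax feas'; rewrite gerBl ltW.
- apply: ge_ereal_sup => _ [[w r] /= feas <-].
  apply/lee_addgt0Pr => delta delta0.
  have [eta eta0 tighten] := lp_tighten e01 feas0 theta0_lt delta0.
  have feas_eta : lp_feasible xh yh (theta + eta) varepsilon Nb (~` S z) w r.
    by apply: relax feas; rewrite lerDl ltW.
  have [w' [r' [feas' obj]]] := tighten w r feas_eta.
  have [P ambP objP] :=
    close_of_lp epsilon Nb_fin Sc_fin eta0 feas'.
  apply: (@le_trans _ _ (lp_objective epsilon w' r' + delta)%:E).
    by rewrite lee_fin -lerBlDr.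
  rewrite EFinD leeD2r//; apply: le_trans objP _.
  by apply: ereal_sup_ubound; exists P.
Qed.
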